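(* Let $C_\bullet$ be a chain complex of finite-dimensional vector spaces over a field $\mathbb{F}$, where each $C_k$ is equipped with a chosen basis and the induced symmetric bilinear form. Fix a degree $k$. The following are equivalent. (1) Every homology class in $H_k$ has a unique harmonic representative. (2) For every homology class in $H_k$ that has a harmonic representative, that representative is unique. (3) The only harmonic representative of the trivial homology class $[0]\in H_k$ is $0$. (4) The quotient map $z\mapsto [z]$ restricts to an isomorphism $Z_k\cap Z^k\to H_k$. (5) $B_k\cap Z^k=0$. (6) $C_k = B_k\oplus Z^k$ (internal direct sum). (7) $\ker(\partial_{k+1}^*\partial_{k+1})=\ker(\partial_{k+1})$. (8) $\operatorname{im}(\partial_{k+1}^*\partial_{k+1})=\operatorname{im}(\partial_{k+1}^* )$. (9) The Moore-Penrose pseudoinverse $\pi^\dagger$ of the projection map $\pi:C_k\to C_k/B_k$ exists. Furthermore, if these statements hold, then the pseudoinverse $\pi^\dagger$ of (9) takes every homology class (viewed as an element of $H_k=Z_k/B_k\subseteq C_k/B_k$) to its unique harmonic representative.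
   Context: $C_\bullet$ has differentials $\partial_k:C_k\to C_{k-1}$ with $\partial_{k-1}\partial_k=0$, indexed by $k\in\mathbb{Z}$. The chosen basis $\{\alpha_i\}$ of $C_k$ induces the symmetric bilinear form $b_k(\alpha_i,\alpha_j)=\delta_{ij}$, which identifies $C_k$ with its dual $C^k=\operatorname{Hom}(C_k,\mathbb{F})$. Under this identification the codifferential $\partial_k^*$ (dual of $\partial_k$, i.e. the transpose matrix in the chosen bases) is a linear map $C_{k-1}\to C_k$. Set $Z_k=\ker\partial_k$, $B_k=\operatorname{im}\partial_{k+1}$, $H_k=Z_k/B_k$, and $Z^k=\ker\partial_{k+1}^*$, $B^k=\operatorname{im}\partial_k^*$, both regarded as subspaces of $C_k$. A chain $c\in C_k$ is harmonic if $\partial_k c=0$ and $\partial_{k+1}^*c=0$, i.e. $c\in Z_k\cap Z^k$. A harmonic representative of a class $h\in H_k$ is a harmonic chain $c$ with $[c]=h$. Pseudoinverse: for an $m\times n$ matrix $A$ over $\mathbb{F}$ with transpose $A^*$, a (Moore-Penrose) pseudoinverse is an $n\times m$ matrix $A^\dagger$ with $AA^\dagger A=A$, $A^\dagger AA^\dagger=A^\dagger$, and $AA^\dagger$, $A^\dagger A$ both symmetric; it is unique if it exists. For a surjective linear map $\phi:V\to W$ with $V$ equipped with a chosen basis, the pseudoinverse $\phi^\dagger:W\to V$ is the map represented by $A^\dagger$, where $A$ is the matrix of $\phi$ in the chosen basis of $V$ and some basis of $W$; neither existence nor the resulting map depends on the basis of $W$. Here $\pi$ is the canonical projection and $C_k$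 has its chosen basis. *)

(* Defs.v *)
From HB Require Import structures.
From mathcomp Require Import all_boot all_order all_algebra.
From mathcomp Require Import generic_quotient ring_quotient.

Set Implicit Arguments.
Unset Strict Implicit.
Unset Printing Implicit Defensive.

Import GRing.Theory.
Import passmx.

Local Open Scope ring_scope.
Local Open Scope quotient_scope.

(* The library quotients a zmodType by a
   subgroup (Quotient.quot identifies x and y when x - y \in U); here the scalar
   action and a finite dimension are added. *)
Section QuotientSpace.
Variables (F : fieldType) (V : vectType F) (U : {vspace V}).

Definition quotv : Type := Quotient.quot (pred_of_vspace U).
HB.instance Definition _ := GRing.Zmodule.on quotv.

Definition quotv_class (v : V) : quotv := \pi_(Quotient.quot (pred_of_vspace U)) v.

Lemma quotv_class_eq x y : (quotv_class x == quotv_class y) = (x - y \in U).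
Proof. by rewrite Quotient.idealrBE. Qed.

Lemma quotv_class_surj q : exists v, quotv_class v = q.
Proof. by exists (repr (q : Quotient.quot (pred_of_vspace U))); exact: reprK. Qed.

Lemma quotv_classD : {morph quotv_class : x y / x + y}.
Proof. exact: Quotient.pi_add. Qed.

Definition quotv_scale (a : F) (q : quotv) : quotv :=
  quotv_class (a *: repr (q : Quotient.quot (pred_of_vspace U))).

Lemma quotv_class_scale a v : quotv_scale a (quotv_class v) = quotv_class (a *: v).
Proof.
apply/eqP; rewrite quotv_class_eq -scalerBr rpredZ// -quotv_class_eq.
by apply/eqP; exact: reprK.
Qed.

Lemma quotv_scaleA a b q :
  quotv_scale a (quotv_scale b q) = quotv_scale (a * b) q.
Proof. by have [v <-] := quotv_class_surj q; rewrite !quotv_class_scale scalerA. Qed.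

Lemma quotv_scale1 : left_id 1 quotv_scale.
Proof.
by move=> q; have [v <-] := quotv_class_surj q; rewrite quotv_class_scale scale1r.
Qed.

Lemma quotv_scaleDr : right_distributive quotv_scale +%R.
Proof.
move=> a p q; have [u <-] := quotv_class_surj p; have [v <-] := quotv_class_surj q.
by rewrite -quotv_classD !quotv_class_scale -quotv_classD scalerDr.
Qed.

Lemma quotv_scaleDl q : {morph quotv_scale^~ q : a b / a + b}.
Proof.
move=> a b; have [v <-] := quotv_class_surj q.
by rewrite !quotv_class_scale -quotv_classD scalerDl.
Qed.

HB.instance Definition _ := GRing.Zmodule_isLmodule.Build F quotv
  quotv_scaleA quotv_scale1 quotv_scaleDr quotv_scaleDl.

Lemma quotv_class_linear : linear quotv_class.
Proof. by move=> a u v; rewrite quotv_classD -quotv_class_scale. Qed.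
HB.instance Definition _ := GRing.isSemilinear.Build F V quotv _ quotv_class
  (GRing.semilinear_linear quotv_class_linear).

Fact quotv_vect_iso : Vector.axiom (\dim U^C) quotv.
Proof.
have UC0 : (U^C :&: U = 0)%VS by rewrite capvC capv_compl.
pose p := daddv_pi U^C U.
have pU x : x \in U -> p x = 0.
  move=> xU; have := daddv_pi_add UC0 (_ : x \in (U^C + U)%VS).
  rewrite addvC addv_complf memvf => /(_ isT).
  rewrite (daddv_pi_id (V := U^C)) ?capv_compl// => /(canRL (addrK x)).
  by rewrite subrr.
have subp x : x - p x \in U.
  have := daddv_pi_add UC0 (_ : x \in (U^C + U)%VS).
  rewrite addvC addv_complf memvf => /(_ isT) {1}<-.
  by rewrite -/p addrAC subrr add0r memv_pi.
pose f q := \row_i coord (vbasis U^C) i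
              (p (repr (q : Quotient.quot (pred_of_vspace U)))).
have fE v : f (quotv_class v) = \row_i coord (vbasis U^C) i (p v).
  apply/rowP=> i; rewrite !mxE; congr (coord _ _ _).
  apply/eqP; rewrite -subr_eq0 -raddfB; apply/eqP/pU.
  by rewrite -quotv_class_eq; apply/eqP; exact: reprK.
exists f.
  move=> a q r; have [u <-] := quotv_class_surj q; have [v <-] := quotv_class_surj r.
  rewrite -linearP !fE; apply/rowP=> i.
  by rewrite !mxE !linearP.
exists (fun w : 'rV_(\dim U^C) => quotv_class (\sum_i w 0 i *: (vbasis U^C)`_i)).
  move=> q; have [v <-] := quotv_class_surj q; rewrite fE.
  under eq_bigr do rewrite mxE.
  rewrite -coord_vbasis ?memv_pi//; apply/eqP.
  by rewrite quotv_class_eq -opprB rpredN subp.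
move=> w; rewrite fE; apply/rowP=> i; rewrite mxE /p daddv_pi_id//; last first.
  by apply: rpred_sum => j _; rewrite rpredZ ?vbasis_mem ?memt_nth.
by rewrite coord_sum_free ?(basis_free (vbasisP _)).
Qed.

HB.instance Definition _ := Lmodule_hasFinDim.Build F quotv quotv_vect_iso.

Definition quotv_proj : 'Hom(V, quotv) := linfun quotv_class.

Lemma quotv_projE v : quotv_proj v = quotv_class v.
Proof. exact: lfunE. Qed.

End QuotientSpace.

(* Only the components diff (k + 1) k carry information: having a map for every
   pair of degrees avoids transports along equalities such as k - 1 + 1 = k. *)
Record based_complex (F : fieldType) := BasedComplex {
  chains :> int -> vectType F;
  chain_basis : forall k, (\dim {:chains k}).-tuple (chains k);
  chain_basisP : forall k, basis_of {:chains k} (chain_basis k);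
  diff : forall i j : int, 'Hom(chains i, chains j);
  diff_shape : forall i j : int, i != j + 1 -> diff i j = 0;
  diff_diff : forall i j k : int, (diff j k \o diff i j)%VF = 0
}.

Section Harmonic.
Variables (F : fieldType) (C : based_complex F).
Implicit Types i j k : int.

Definition chain_form k (x y : C k) : F :=
  \sum_a coord (chain_basis C k) a x * coord (chain_basis C k) a y.

(* [mxof] and [hommx] use the row-vector convention; transposition commutes
   with the change to column vectors. *)
Definition codiff i j : 'Hom(C j, C i) :=
  hommx (chain_basis C j) (chain_basis C i)
    (mxof (chain_basis C i) (chain_basis C j) (diff C i j))^T.

Lemma chain_formE k (x y : C k) :
  chain_form x y =
  (rVof (chain_basis C k) x *m (rVof (chain_basis C k) y)^T) 0 0.
Proof. by rewrite mxE; apply: eq_bigr => a _; rewrite !mxE. Qed.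

Lemma codiff_adjoint i j (x : C i) (y : C j) :
  chain_form (diff C i j x) y = chain_form x (codiff i j y).
Proof.
rewrite !chain_formE (rVof_app _ (chain_basisP C i)).
by rewrite -rVof_mul ?chain_basisP// trmx_mul trmxK mulmxA.
Qed.

Definition cycles k : {vspace C k} := lker (diff C k (k - 1)).
Definition boundaries k : {vspace C k} := limg (diff C (k + 1) k).
Definition cocycles k : {vspace C k} := lker (codiff (k + 1) k).

Definition proj_boundaries k : 'Hom(C k, quotv (boundaries k)) :=
  quotv_proj (boundaries k).

(* Z_k / B_k, as a subspace of C_k / B_k. *)
Definition homology k : {vspace quotv (boundaries k)} :=
  (proj_boundaries k @: cycles k)%VS.

Definition harmonic k (c : C k) : Prop :=
  diff C k (k - 1) c = 0 /\ codiff (k + 1) k c = 0.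

Definition harmonic_rep k (h : quotv (boundaries k)) (c : C k) : Prop :=
  harmonic c /\ proj_boundaries k c = h.

End Harmonic.

(* As f is linear, this says that f restricts to an isomorphism from U to W. *)
Definition restricts_to_iso (F : fieldType) (V1 V2 : vectType F)
    (f : 'Hom(V1, V2)) (U : {vspace V1}) (W : {vspace V2}) : Prop :=
  [/\ forall u, u \in U -> f u \in W,
      {in U &, injective f}
    & forall w, w \in W -> exists2 u, u \in U & f u = w].

Definition mx_pseudoinverse (F : fieldType) m n
    (A : 'M[F]_(m, n)) (X : 'M[F]_(n, m)) : Prop :=
  [/\ A *m X *m A = A, X *m A *m X = X,
      (A *m X)^T = A *m X & (X *m A)^T = X *m A].

(* For f surjective the choice of the basis eW of W is irrelevant.  The
   conditions of [mx_pseudoinverse] are stable under transposing both matrices,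
   so that the row-vector convention of [mxof] is harmless. *)
Definition pseudoinverse (F : fieldType) (V W : vectType F)
    (eV : (\dim {:V}).-tuple V) (f : 'Hom(V, W)) (g : 'Hom(W, V)) : Prop :=
  exists2 eW : (\dim {:W}).-tuple W, basis_of {:W} eW &
    mx_pseudoinverse (mxof eV eW f) (mxof eW eV g).

(* Main.v *)
(** Z^k is the orthogonal of B_k for the nondegenerate form b_k, and adjoint maps
    have equal rank, so dim B_k + dim Z^k = dim C_k over every field: the
    conditions all say that B_k meets Z^k only in 0. As pi is onto, a map p is its
    pseudoinverse iff pi p = 1 and p pi is self-adjoint; then p pi is the
    projection onto Z^k along B_k. *)
Require Import Defs.
From mathcomp Require Import all_boot all_order all_algebra.
Import GRing.Theory.
Import passmx.
Local Open Scope ring_scope.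

Set Implicit Arguments.
Unset Strict Implicit.
Unset Printing Implicit Defensive.

(** * The symmetric bilinear form on chains *)

Lemma chain_formC (F : fieldType) (C : based_complex F) k (x y : C k) :
  chain_form x y = chain_form y x.
Proof. by apply: eq_bigr => a _; rewrite mulrC. Qed.

Lemma chain_form_linear (F : fieldType) (C : based_complex F) k (x : C k) :
  linear_for *%R (chain_form x).
Proof.
move=> a y z; rewrite /chain_form mulr_sumr -big_split/=.
by apply: eq_bigr => i _; rewrite linearP/= mulrDr mulrCA.
Qed.

Lemma chain_formDr (F : fieldType) (C : based_complex F) k (x y z : C k) :
  chain_form x (y + z) = chain_form x y + chain_form x z.
Proof. by rewrite -[y]scale1r chain_form_linear mul1r scale1r. Qed.

Lemma chain_form0r (F : fieldType) (C : based_complex F) k (x : C k) :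
  chain_form x 0 = 0.
Proof. by apply/(addrI (chain_form x 0)); rewrite -chain_formDr !addr0. Qed.

Lemma chain_form_basis (F : fieldType) (C : based_complex F) k (x : C k)
    (i : 'I_(\dim {:C k})) :
  chain_form (chain_basis C k)`_i x = coord (chain_basis C k) i x.
Proof.
have freeC := basis_free (chain_basisP C k).
rewrite /chain_form (bigD1 i)//= coord_free// eqxx mul1r big1 ?addr0// => j ji.
by rewrite coord_free// eq_sym (negPf ji) mul0r.
Qed.

Lemma chain_form_nondeg (F : fieldType) (C : based_complex F) k (x : C k) :
  (forall y, chain_form y x = 0) -> x = 0.
Proof.
move=> x0; rewrite (coord_basis (chain_basisP C k) (memvf x)).
by rewrite big1// => i _; rewrite -chain_form_basis x0 scale0r.
Qed.

(** * Adjoint maps and their ranks *)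

Definition adjoint (F : fieldType) (C : based_complex F) {i j}
    (f : 'Hom(C i, C j)) (g : 'Hom(C j, C i)) : Prop :=
  forall x y, chain_form (f x) y = chain_form x (g y).

Lemma adjointC (F : fieldType) (C : based_complex F) i j
    (f : 'Hom(C i, C j)) (g : 'Hom(C j, C i)) :
  adjoint f g -> adjoint g f.
Proof. by move=> fg x y; rewrite chain_formC -fg chain_formC. Qed.

(** By nondegeneracy, [g y = 0] iff [g y] is orthogonal to every [x]; adjointness turns this into a
    pairing of [f x] with [y]. *)
Lemma mem_lker_adjoint (F : fieldType) (C : based_complex F) i j
    (f : 'Hom(C i, C j)) (g : 'Hom(C j, C i)) y :
  adjoint f g ->
  y \in lker g <-> {in limg f, forall x, chain_form x y = 0}.
Proof.
move=> fg; rewrite memv_ker; split=> [/eqP gy0 _ /memv_imgP[x _ ->]|fy0].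
  by rewrite fg gy0 chain_form0r.
by apply/eqP/chain_form_nondeg => x; rewrite -fg fy0// memv_img ?memvf.
Qed.

(* [lker g] is cut out by the [\dim (limg f)] linear equations
   [chain_form b _ = 0], for b in a basis of [limg f]. *)
Lemma dim_limg_adjoint_le (F : fieldType) (C : based_complex F) i j
    (f : 'Hom(C i, C j)) (g : 'Hom(C j, C i)) :
  adjoint f g -> (\dim (limg g) <= \dim (limg f))%N.
Proof.
move=> fg; pose r : nat := \dim (limg f); pose X := vbasis (limg f).
pose M := \matrix_(a < \dim {:C j}, b < r) coord (chain_basis C j) a X`_b.
pose h := linfun (mulmxr M \o rVof (chain_basis C j)).
have hE y b : h y 0 b = chain_form X`_b y.
  by rewrite lfunE !mxE; apply: eq_bigr => a _; rewrite !mxE mulrC.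
have sub_ker : (lker h <= lker g)%VS.
  apply/subvP=> y; rewrite memv_ker => /eqP hy0.
  apply/(mem_lker_adjoint y fg) => x /coord_vbasis ->.
  rewrite chain_formC; elim/big_rec: _ => [|a z _ IH]; first exact: chain_form0r.
  by rewrite chain_form_linear IH addr0 chain_formC -hE hy0 mxE mulr0.
(* Rank-nullity for [g] and [h], both defined on [C j], turns the inclusion of kernels into a bound
   on the rank of [g] by that of [h], hence by [r]. *)
have := limg_ker_dim g fullv; rewrite capfv => dim_g.
have := limg_ker_dim h fullv; rewrite capfv => dim_h.
have dim_rV : (\dim (limg h) <= r)%N.
  by rewrite (leq_trans (dimvS (subvf _)))// dimvf /dim/= mul1n.
rewrite -(leq_add2l (\dim (lker g))) dim_g -dim_h.
by rewrite leq_add// dimvS.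
Qed.

Lemma dim_limg_adjoint (F : fieldType) (C : based_complex F) i j
    (f : 'Hom(C i, C j)) (g : 'Hom(C j, C i)) :
  adjoint f g -> \dim (limg g) = \dim (limg f).
Proof.
by move=> fg; apply/eqP; rewrite eqn_leq !dim_limg_adjoint_le//; exact: adjointC.
Qed.

(** * Pseudoinverses in terms of adjoints *)

Lemma trmx_mxof_adjoint (F : fieldType) (C : based_complex F) k
    (h : 'End(C k)) :
  (mxof (chain_basis C k) (chain_basis C k) h)^T =
    mxof (chain_basis C k) (chain_basis C k) h <-> adjoint h h.
Proof.
have eP := chain_basisP C k; set e := chain_basis C k in eP *.
split=> [hT x y|hh].
  by rewrite !chain_formE !(rVof_app _ eP) trmx_mul hT mulmxA.
(* The chosen basis is orthonormal, so matrix entries are values of the form. *)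
have mxofE a b : mxof e e h a b = chain_form e`_b (h e`_a).
  by rewrite chain_form_basis !mxE/= vecof_delta.
by apply/matrixP=> a b; rewrite mxE !mxofE -hh chain_formC.
Qed.

(** Surjectivity turns [f g f = f] into [f g = 1], from which [g f g = g] and the symmetry of [f g]
    follow; symmetry of the matrix of [g f] is self-adjointness. *)
Lemma pseudoinverse_adjoint (F : fieldType) (C : based_complex F) k
    (W : vectType F) (f : 'Hom(C k, W)) (g : 'Hom(W, C k)) :
  limg f = fullv ->
  pseudoinverse (chain_basis C k) f g <->
    cancel g f /\ adjoint (g \o f)%VF (g \o f)%VF.
Proof.
move=> f_surj; have eP := chain_basisP C k; split.
  case=> eW eWP; rewrite /mx_pseudoinverse -!mxof_comp// => -[fgf _ gfT _].
  split; last exact/trmx_mxof_adjoint.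
  have {}fgf := can_inj (mxofK eP eWP) fgf.
  move=> w; have : w \in limg f by rewrite f_surj memvf.
  by case/memv_imgP=> x _ ->; rewrite -[in RHS]fgf !comp_lfunE.
(* Any basis of [W] serves, since [f \o g = 1] has the identity matrix in each of them. *)
case=> gK /trmx_mxof_adjoint gfT; exists (vbasis fullv); first exact: vbasisP.
have fg1 : (f \o g)%VF = \1%VF by apply/lfunP=> w; rewrite !lfunE/= gK.
have eWP := vbasisP {:W}; split; rewrite -?mxof_comp//.
- by rewrite comp_lfunA fg1 comp_lfun1l.
- by rewrite fg1 comp_lfun1r.
- by rewrite fg1 mxof1 ?trmx1// (basis_free eWP).
Qed.

(** * Boundaries, cocycles and the quotient map *)

Lemma diff_codiff_adjoint (F : fieldType) (C : based_complex F) i j :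
  adjoint (diff C i j) (codiff C i j).
Proof. exact: codiff_adjoint. Qed.

Lemma mem_cocycles (F : fieldType) (C : based_complex F) k (y : C k) :
  y \in cocycles C k <->
    {in boundaries C k, forall x, chain_form x y = 0}.
Proof. exact/mem_lker_adjoint/diff_codiff_adjoint. Qed.

Lemma dim_boundaries_cocycles (F : fieldType) (C : based_complex F) k :
  (\dim (boundaries C k) + \dim (cocycles C k))%N = \dim {:C k}.
Proof.
rewrite -(dim_limg_adjoint (@diff_codiff_adjoint _ C (k + 1) k)).
by rewrite addnC -(limg_ker_dim (codiff C (k + 1) k) fullv) capfv.
Qed.

Lemma boundaries_subset_cycles (F : fieldType) (C : based_complex F) k :
  (boundaries C k <= cycles C k)%VS.
Proof.
apply/subvP=> _ /memv_imgP[x _ ->].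
by rewrite memv_ker -comp_lfunE diff_diff lfunE.
Qed.

Lemma proj_boundaries_eq0 (F : fieldType) (C : based_complex F) k (x : C k) :
  (proj_boundaries C k x == 0) = (x \in boundaries C k).
Proof.
by rewrite -(linear0 (proj_boundaries C k)) /= !quotv_projE -[x in RHS]subr0
  -quotv_class_eq.
Qed.

Lemma limg_proj_boundaries (F : fieldType) (C : based_complex F) k :
  limg (proj_boundaries C k) = fullv.
Proof.
apply/vspaceP=> q; rewrite memvf; apply/memv_imgP.
by have [v <-] := quotv_class_surj q; exists v; rewrite ?memvf ?quotv_projE.
Qed.

Lemma harmonicP (F : fieldType) (C : based_complex F) k (c : C k) :
  harmonic c <-> c \in (cycles C k :&: cocycles C k)%VS.
Proof.
rewrite memv_cap !memv_ker; by split=> [[-> ->]|/andP[/eqP ? /eqP ?]]; rewrite ?eqxx.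
Qed.

Lemma memv_eq0 (F : fieldType) (V : vectType F) (U : {vspace V}) :
  {in U, forall x, x = 0} -> U = 0%VS.
Proof.
by move=> U0; apply/eqP; rewrite -subv0; apply/subvP=> x /U0 ->; rewrite mem0v.
Qed.

(** * The pseudoinverse of the projection *)

Lemma pseudoinverse_boundaries_cocycles
    (F : fieldType) (C : based_complex F) k (p : 'Hom(quotv (boundaries C k), C k)) :
  pseudoinverse (chain_basis C k) (proj_boundaries C k) p ->
  (boundaries C k :&: cocycles C k = 0)%VS.
Proof.
move/(pseudoinverse_adjoint _ (limg_proj_boundaries C k)).
move=> [pK p_adj]; apply: memv_eq0 => c; rewrite memv_cap => /andP[cB cZ].
apply: chain_form_nondeg => v; set P := (p \o _)%VF in p_adj.
have vB : v - P v \in boundaries C k.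
  by rewrite -proj_boundaries_eq0 linearB/= comp_lfunE pK subrr.
(* Split [v] as [(v - P v) + P v]: the cocycle [c] is orthogonal to the boundary [v - P v], and
   self-adjointness replaces the pairing with [P v] by one with [P c = 0]. *)
rewrite -(subrK (P v) v) chain_formC chain_formDr.
rewrite 2![chain_form c _]chain_formC.
rewrite (proj1 (mem_cocycles c) cZ _ vB) add0r p_adj comp_lfunE.
by move: cB; rewrite -proj_boundaries_eq0 => /eqP ->; rewrite linear0 chain_form0r.
Qed.

Lemma pseudoinverse_harmonic_rep
    (F : fieldType) (C : based_complex F) k (p : 'Hom(quotv (boundaries C k), C k)) :
  pseudoinverse (chain_basis C k) (proj_boundaries C k) p ->
  {in homology C k, forall h, unique (@harmonic_rep F C k h) (p h)}.
Proof.
move=> pP h hH; have BZ0 := pseudoinverse_boundaries_cocycles pP.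
move: pP => /(pseudoinverse_adjoint _ (limg_proj_boundaries C k)).
move=> [pK p_adj].
have phZ : p h \in cycles C k.
  case/memv_imgP: hH => z zZ hz; rewrite -(subrK z (p h)) rpredD//.
  apply: (subvP (boundaries_subset_cycles C k)).
  by rewrite -proj_boundaries_eq0 linearB/= pK hz subrr.
have phZ' : p h \in cocycles C k.
  apply/mem_cocycles => x xB.
  (* [p h] is fixed by [p \o pi]; self-adjointness moves this map onto the boundary [x], which it
     kills. *)
  rewrite -[in p _](pK h) -[p _](comp_lfunE p (proj_boundaries C k)) -p_adj.
  rewrite comp_lfunE.
  move: xB; rewrite -proj_boundaries_eq0 => /eqP ->.
  by rewrite linear0 chain_formC chain_form0r.
split; first by split; [apply/harmonicP; rewrite memv_cap phZ|].
move=> c [/harmonicP]; rewrite memv_cap => /andP[_ cZ'] ch.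
(* Two harmonic representatives of [h] differ by a boundary that is also a cocycle. *)
apply/eqP; rewrite -subr_eq0 -memv0 -BZ0 memv_cap -proj_boundaries_eq0.
by rewrite linearB/= pK ch subrr eqxx rpredB.
Qed.

Lemma pseudoinverse_exists (F : fieldType) (C : based_complex F) k :
  (boundaries C k :&: cocycles C k = 0)%VS ->
  (boundaries C k + cocycles C k = fullv)%VS ->
  exists p : 'Hom(quotv (boundaries C k), C k),
    pseudoinverse (chain_basis C k) (proj_boundaries C k) p.
Proof.
set B := boundaries C k; set Z := cocycles C k; set pi := proj_boundaries C k.
move=> BZ0 BZ1; have ZB0 : (Z :&: B = 0)%VS by rewrite capvC.
have pi_surj := limg_proj_boundaries C k.
pose P := daddv_pi Z B.
have subP x : x - P x \in B.
  rewrite -[X in X - _](daddv_pi_add ZB0 (w := x)) ?[(Z + B)%VS]addvC ?BZ1 ?memvf//.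
  by rewrite addrAC subrr add0r memv_pi.
have P0 x : x \in B -> P x = 0.
  move=> xB; apply/eqP; rewrite -memv0 -ZB0 memv_cap memv_pi/=.
  by rewrite -(opprK (P x)) rpredN -(rpredDl _ xB).
(* As [x - P x] is a boundary and [P y] a cocycle, the pairing depends only on [P x] and [P y],
   which makes [P] self-adjoint. *)
have orthP x y : chain_form x (P y) = chain_form (P x) (P y).
  have xP0 := proj1 (mem_cocycles (P y)) (memv_pi _ _ _) _ (subP x).
  rewrite -[x in LHS](subrK (P x)) chain_formC chain_formDr.
  by rewrite ![chain_form (P y) _]chain_formC xP0 add0r.
(* [pi^-1] is a linear section of [pi]; since [P] kills boundaries, the composite is the map that
   [P] induces on the quotient. *)
exists (P \o pi^-1)%VF; apply/(pseudoinverse_adjoint _ pi_surj).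
have piV q : pi ((pi^-1)%VF q) = q by rewrite limg_lfunVK// pi_surj memvf.
have PpiV x : ((P \o pi^-1) \o pi)%VF x = P x.
  rewrite !comp_lfunE; apply/eqP; rewrite -subr_eq0 -linearB/= P0//.
  by rewrite -proj_boundaries_eq0 linearB/= piV subrr.
split=> [q|x y]; last by rewrite !PpiV orthP chain_formC orthP chain_formC.
rewrite comp_lfunE -[RHS]piV; apply/eqP.
by rewrite eq_sym -subr_eq0 -linearB/= proj_boundaries_eq0 subP.
Qed.

(** * The cycle of implications *)

Theorem theoremA (F : fieldType) (C : based_complex F) (k : int) :
  [<->
    (* 1 *) forall h, h \in homology C k -> exists! c : C k, harmonic_rep h c;
    (* 2 *) forall h, h \in homology C k ->
              forall c c' : C k, harmonic_rep h c -> harmonic_rep h c' -> c = c';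
    (* 3 *) forall c : C k, harmonic_rep (proj_boundaries C k 0) c <-> c = 0;
    (* 4 *) restricts_to_iso (proj_boundaries C k)
              (cycles C k :&: cocycles C k)%VS (homology C k);
    (* 5 *) (boundaries C k :&: cocycles C k)%VS = 0%VS;
    (* 6 *) (boundaries C k + cocycles C k)%VS = {:C k}%VS /\
            directv (boundaries C k + cocycles C k);
    (* 7 *) lker (codiff C (k + 1) k \o diff C (k + 1) k)%VF =
            lker (diff C (k + 1) k);
    (* 8 *) limg (codiff C (k + 1) k \o diff C (k + 1) k)%VF =
            limg (codiff C (k + 1) k);
    (* 9 *) exists p : 'Hom(quotv (boundaries C k), C k),
              pseudoinverse (chain_basis C k) (proj_boundaries C k) p
  ] /\
  (forall p : 'Hom(quotv (boundaries C k), C k),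
    pseudoinverse (chain_basis C k) (proj_boundaries C k) p ->
    forall h, h \in homology C k -> unique (@harmonic_rep F C k h) (p h)).
Proof.
have BsubZ := subvP (boundaries_subset_cycles C k).
have sum_full : (boundaries C k :&: cocycles C k = 0)%VS ->
    (boundaries C k + cocycles C k = fullv)%VS.
  move=> BZ0; apply/eqP; rewrite eqEdim subvf/=.
  by rewrite dimv_disjoint_sum// dim_boundaries_cocycles.
split; last by move=> p pP h; exact: pseudoinverse_harmonic_rep.
tfae.
- move=> uniq_rep h /uniq_rep[c0 [_ c0_uniq]] c c' /c0_uniq <- /c0_uniq <- //.
- have zero_rep : harmonic_rep (proj_boundaries C k 0) (0 : C k).
    by split=> //; apply/harmonicP; rewrite mem0v.
  move=> uniq_rep c; split=> [c_rep|->//].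
  by apply: uniq_rep c_rep zero_rep; rewrite linear0 mem0v.
- move=> uniq0.
  have BZ0 : (boundaries C k :&: cocycles C k = 0)%VS.
    (* A boundary that is a cocycle is a harmonic representative of the zero class. *)
    apply: memv_eq0 => c; rewrite memv_cap => /andP[cB cZ'].
    apply/uniq0; split; first by apply/harmonicP; rewrite memv_cap BsubZ.
    by apply/eqP; rewrite linear0 proj_boundaries_eq0.
  split=> [u|u v|h /memv_imgP[z zZ ->]].
  + by rewrite memv_cap => /andP[uZ _]; exact: memv_img.
  + rewrite !memv_cap => /andP[_ uZ'] /andP[_ vZ'] /eqP.
    rewrite -subr_eq0 -linearB/= proj_boundaries_eq0 => uvB.
    by apply/eqP; rewrite -subr_eq0 -memv0 -BZ0 memv_cap uvB rpredB.
  (* The cocycle part [w] of the cycle [z] is again a cycle, because its boundary part [b] is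
     one. *)
  + have : z \in (boundaries C k + cocycles C k)%VS by rewrite sum_full ?memvf.
    case/memv_addP=> b bB [w wZ' zE]; exists w.
      by rewrite memv_cap wZ' -(rpredDl _ (BsubZ _ bB)) -zE zZ.
    by apply/eqP; rewrite eq_sym -subr_eq0 -linearB/= zE addrK proj_boundaries_eq0.
- case=> _ inj _; apply: memv_eq0 => c; rewrite memv_cap => /andP[cB cZ'].
  apply: inj; rewrite ?mem0v// ?memv_cap ?cZ' ?BsubZ//.
  by apply/eqP; rewrite linear0 proj_boundaries_eq0.
- by move=> BZ0; split; [exact: sum_full|exact/directv_addP].
- case=> _ /directv_addP BZ0; apply/vspaceP=> x; rewrite !memv_ker comp_lfunE.
  apply/idP/idP => [dx0|/eqP ->]; last by rewrite linear0.
  (* If the composite kills [x], then the differential of [x] is both a boundary and a cocycle. *)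
  by rewrite -memv0 -BZ0 memv_cap memv_img ?memvf// memv_ker.
(* One inclusion of images is clear; equal kernels and rank-nullity give the composite the rank of
   the differential, which is that of its adjoint. *)
- move=> ker_eq; apply/eqP; rewrite eqEdim limg_comp limgS ?subvf//=.
  rewrite (dim_limg_adjoint (@diff_codiff_adjoint _ C (k + 1) k)).
  rewrite -limg_comp -(leq_add2l (\dim (lker (diff C (k + 1) k)))) -{2}ker_eq.
  have := limg_ker_dim (diff C (k + 1) k) fullv; rewrite capfv => ->.
  by have := limg_ker_dim (codiff C (k + 1) k \o diff C (k + 1) k) fullv;
     rewrite capfv => ->.
- move=> img_eq.
  have BZ0 : (boundaries C k :&: cocycles C k = 0)%VS.
    (* Rank-nullity for the codifferential restricted to the boundaries: its image there is its
       whole image, of the same dimension as the boundaries, so nothing is left for the kernel. *)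
    apply/eqP; rewrite -dimv_eq0.
    have := limg_ker_dim (codiff C (k + 1) k) (boundaries C k).
    rewrite -limg_comp img_eq.
    rewrite (dim_limg_adjoint (@diff_codiff_adjoint _ C (k + 1) k)).
    by move/(canRL (addnK _)) ->; rewrite subnn.
  exact: pseudoinverse_exists BZ0 (sum_full BZ0).
- by case=> p pP h hH; exists (p h); exact: pseudoinverse_harmonic_rep.
Qed.
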